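(* Let $\mathcal A$ be the arithmetic inverse monoid, i.e. the inverse subsemigroup of $\mathcal I(\mathbb N)$ generated by $\{R_{a,b} : a>b\in\mathbb N\}$. (1) Every non-zero element of $\mathcal A$ may be written as $R^\ddagger_{c,d}R_{a,b}$ for some $c>d$, $a>b\in\mathbb N$. (2) For all $a>b$, $c>d$, $e>f$, $g>h$ in $\mathbb N$, composition of such normal forms is given by $$\left(R^\ddagger_{g,h}R_{e,f}\right)\left(R^\ddagger_{c,d}R_{a,b}\right)=\begin{cases} R^\ddagger_{gw,\,gx+h}\,R_{au,\,av+b} & \text{if } |d-f|\in\gcd(c,e)\mathbb N,\\ \epsilon & \text{otherwise,}\end{cases}$$ where, in the first case, $r$ is the natural number with $r<\mathrm{lcm}(c,e)$ and $(c\mathbb N+d)\cap(e\mathbb N+f)=\mathrm{lcm}(c,e)\mathbb N+r$, and $$u=\frac{e}{\gcd(c,e)},\quad v=\frac{r-d}{c},\quad w=\frac{c}{\gcd(c,e)},\quad x=\frac{r-f}{e}.$$ Explicitly, in the first case, $$\left(R^\ddagger_{g,h}R_{e,f}\right)\left(R^\ddagger_{c,d}R_{a,b}\right)=R^\ddagger_{\frac{gc}{\gcd(c,e)},\,\frac{g(r-f)}{e}+h}\;R_{\frac{ae}{\gcd(c,e)},\,\frac{a(r-d)}{c}+b}=R^\ddagger_{\frac{g\,\mathrm{lcm}(c,e)}{e},\,\frac{g(r-f)}{e}+h}\;R_{\frac{a\,\mathrm{lcm}(c,e)}{c},\,\frac{a(r-d)}{c}+b}.$$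
   Context: $\mathbb N=\{0,1,2,\dots\}$. $\mathcal I(\mathbb N)$ is the symmetric inverse monoid on $\mathbb N$: all partial injections $\mathbb N\to\mathbb N$ under composition of partial functions ($fg$ means first $g$, then $f$), with generalised inverse $f^\ddagger(y)=x$ iff $f(x)=y$; its zero element $\epsilon$ is the nowhere-defined partial function. For $a>b\in\mathbb N$, $a\mathbb N+b=\{an+b : n\in\mathbb N\}$ (written $a\mathbb N$ when $b=0$), and $R_{a,b}\in\mathcal I(\mathbb N)$ is the partial injection with domain $a\mathbb N+b$ given by $R_{a,b}(n)=\frac{n-b}{a}$; thus $R_{a,b}^\ddagger(n)=an+b$ for all $n\in\mathbb N$. Note that $R_{1,0}=Id$, so $\mathcal A$ is a monoid. *)

(* Defs.v *)
From mathcomp Require Import all_boot all_order all_algebra.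
From mathcomp Require Import all_classical.

Set Implicit Arguments.
Unset Strict Implicit.
Unset Printing Implicit Defensive.

Local Open Scope nat_scope.
Local Open Scope classical_set_scope.

(** The symmetric inverse monoid I(N): a partial function is an
    [option]-valued one, undefined where its value is [None]. *)
Record pinj := Pinj {
  pfun :> nat -> option nat;
  pfun_inj : forall x y z, pfun x = Some z -> pfun y = Some z -> x = y }.

Lemma pcomp_inj (f g : pinj) x y z :
  pcomp f g x = Some z -> pcomp f g y = Some z -> x = y.
Proof.
rewrite /pcomp; case gx: (g x) => [u|//]; case gy: (g y) => [v|//] /= fu fv.
by move: gx gy; rewrite (pfun_inj fu fv); exact: pfun_inj.
Qed.

(** [pinj_mul f g] applies [g] first, then [f]. *)
Definition pinj_mul (f g : pinj) : pinj := Pinj (@pcomp_inj f g).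

Definition pinv_fun (f : pinj) (y : nat) : option nat :=
  if pselect (exists x, f x = Some y) is left H
  then Some (projT1 (cid H)) else None.

Lemma pinv_funP (f : pinj) x y : pinv_fun f y = Some x <-> f x = Some y.
Proof.
rewrite /pinv_fun; case: pselect => [H|nH]; last first.
  by split=> // fx; case: nH; exists x.
case: cid => x' /= fx'; split=> [[<-]//|fx].
by rewrite (pfun_inj fx fx').
Qed.

Lemma pinv_fun_inj (f : pinj) x y z :
  pinv_fun f x = Some z -> pinv_fun f y = Some z -> x = y.
Proof. by move=> /pinv_funP fx /pinv_funP; rewrite fx => -[]. Qed.

Definition pinj_inv (f : pinj) : pinj := Pinj (@pinv_fun_inj f).

Lemma pinj_eps_inj (x y z : nat) :
  (fun=> None) x = Some z -> (fun=> None) y = Some z -> x = y.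
Proof. by []. Qed.

Definition pinj_eps : pinj := Pinj pinj_eps_inj.

Declare Scope pinj_scope.
Delimit Scope pinj_scope with pinj.
Bind Scope pinj_scope with pinj.
Notation "f * g" := (pinj_mul f g) : pinj_scope.
Notation "f ^‡" := (pinj_inv f) (at level 2, format "f ^‡") : pinj_scope.

Definition progr (a b : nat) : set nat := [set a * n + b | n in [set: nat]].

Definition Rfun (a b n : nat) : option nat :=
  if n \in progr a b then Some ((n - b) %/ a) else None.

Lemma Rfun_inj a b x y z : Rfun a b x = Some z -> Rfun a b y = Some z -> x = y.
Proof.
rewrite /Rfun; case: ifP => // /set_mem[m _ <-] [<-].
case: ifP => // /set_mem[n _ <-] []; rewrite !addnK.
by case: a => [|a] //; rewrite !mulKn// => ->.
Qed.

(** Total in [a] and [b] so that it needs no proof argument; intended for [b < a]. *)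
Definition R (a b : nat) : pinj := Pinj (@Rfun_inj a b).

Lemma R_invE a b n : b < a -> (R a b)^‡%pinj n = Some (a * n + b).
Proof.
move=> ba; apply/pinv_funP; rewrite /= /Rfun mem_set; last by exists n.
by rewrite addnK mulKn// (leq_ltn_trans _ ba).
Qed.

Definition inverse_subsemigroup (S : set pinj) : Prop :=
  (forall f g, S f -> S g -> S (f * g)%pinj) /\ (forall f, S f -> S f^‡%pinj).

Definition arith_monoid : set pinj :=
  smallest inverse_subsemigroup
    [set f | exists a b : nat, b < a /\ f = R a b].

(* Main.v *)
Require Import Defs.
From mathcomp Require Import all_boot all_order all_algebra.
From mathcomp Require Import all_classical.

(** A non-zero product of two normal forms is a reindexing: the middle variable
    runs over the intersection of two residue classes, which by the Chinese
    remainder theorem is empty or a residue class modulo the lcm [c u = e w].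
    Parametrising it as [c (u k + v) + d = e (w k + x) + f] gives the normal
    form of the product, so the normal forms together with the zero element
    form an inverse semigroup. *)

Set Implicit Arguments.
Unset Strict Implicit.
Unset Printing Implicit Defensive.

Local Open Scope nat_scope.
Local Open Scope classical_set_scope.

(** * Graphs of partial injections and of normal forms *)

Lemma pinj_ext (F G : pinj) :
  (forall x y, F x = Some y <-> G x = Some y) -> F = G.
Proof.
case: F G => [F Fi] [G Gi] /= FG.
have eFG : F = G.
  apply/funext => x; case Fx: (F x) => [y|]; first by rewrite (FG x y).1.
  by case Gx: (G x) => [y|//]; rewrite -Fx; apply/FG.
by subst G; rewrite (Prop_irrelevance Fi Gi).
Qed.

Lemma pinj_mulP (F G : pinj) x y :
  (F * G)%pinj x = Some y <-> exists2 z, G x = Some z & F z = Some y.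
Proof.
rewrite /= /pcomp; case: (G x) => [z|] /=; last by split=> // -[].
by split=> [Fz|[_ [<-]]//]; exists z.
Qed.

Lemma R_SomeP a b (ba : b < a) x n : R a b x = Some n <-> x = a * n + b.
Proof.
rewrite -(pinv_funP (R a b)).
have := R_invE n ba; rewrite /= => ->.
by split=> [[->]//|->].
Qed.

Lemma normal_formP a b c d (ba : b < a) (dc : d < c) x y :
  ((R c d)^‡ * R a b)%pinj x = Some y <->
  exists2 n, x = a * n + b & y = c * n + d.
Proof.
rewrite pinj_mulP; split=> [[n]|[n xn ->]].
  by move=> /(R_SomeP ba) ->; rewrite R_invE// => -[<-]; exists n.
by exists n; [apply/R_SomeP | rewrite R_invE].
Qed.

Lemma normal_form_inv a b c d : b < a -> d < c ->
  (((R c d)^‡ * R a b)^‡ = (R a b)^‡ * R c d)%pinj.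
Proof.
move=> ba dc; apply: pinj_ext => x y.
rewrite (pinv_funP ((R c d)^‡ * R a b)%pinj y x) !normal_formP//.
by split=> -[n -> ->]; exists n.
Qed.

(** [R 1 0] is the identity, which makes every generator a normal form. *)
Lemma R_normal_form a b : b < a -> R a b = ((R 1 0)^‡ * R a b)%pinj.
Proof.
move=> ba; apply: pinj_ext => x y; rewrite normal_formP// R_SomeP//.
by split=> [->|[n -> ->]]; [exists y|]; rewrite // mul1n addn0.
Qed.

(** * Intersections of residue classes *)

Lemma progrP c d (dc : d < c) z : progr c d z <-> z = d %[mod c].
Proof.
split=> [[n _ <-]|zd]; first by rewrite mulnC modnMDl.
(* As [d < c], the remainder of [z] is [d] itself, so the quotient serves as index. *)
by exists (z %/ c) => //; rewrite -(modn_small dc) -zd mulnC -divn_eq.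
Qed.

(** For [z <= y] each congruence says that the modulus divides [y - z], and [lcmn c e] divides a
    number exactly when [c] and [e] both do. *)
Lemma eqn_mod_lcm c e y z :
  (y == z %[mod lcmn c e]) = (y == z %[mod c]) && (y == z %[mod e]).
Proof.
wlog zy : y z / z <= y => [hw|]; last by rewrite !eqn_mod_dvd// dvdn_lcm.
by case: (leqP z y) => [|/ltnW] /hw// hzy; rewrite !(eq_sym (y %% _)).
Qed.

Lemma progr_inj L r s : r < L -> s < L -> progr L r = progr L s -> r = s.
Proof.
move=> rL sL rs; have : progr L r r by apply/progrP.
by rewrite rs progrP// !modn_small.
Qed.

Lemma progrI_dvd c e d f : progr c d `&` progr e f !=set0 ->
  gcdn c e %| `|d - f|%N.
Proof.
wlog df : c d e f / d <= f => [hw|[z [[n _ <-] [m _ emf]]]].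
  case: (leqP d f) => [|/ltnW] df; [exact: hw|move=> [z [zc ze]]].
  by rewrite gcdnC distnC; apply: hw => //; exists z.
(* The common member is [c * n + d = e * m + f], so [f - d] is a difference of multiples of the gcd;
   the additive form avoids truncated subtraction. *)
have cm : f - d + e * m = c * n.
  by apply/eqP; rewrite -(eqn_add2r d) addnAC subnK// addnC emf.
rewrite distnEr// -(@dvdn_addl (e * m)).
  by rewrite cm dvdn_mulr// dvdn_gcdl.
by rewrite dvdn_mulr// dvdn_gcdr.
Qed.

Lemma dvd_progrI c e (d f : nat) : 0 < c -> 0 < e -> gcdn c e %| `|d - f|%N ->
  progr c d `&` progr e f !=set0.
Proof.
wlog df : c d e f / d <= f => [hw|] c0 e0.
  case: (leqP d f) => [|/ltnW] df; first exact: hw.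
  by rewrite gcdnC distnC => /(hw _ _ _ _ df e0 c0)[z []]; exists z.
rewrite distnEr// => /dvdnP[q fd].
(* Bézout: [s * c = t * e + gcdn c e]. Multiplied by [q], it yields
   [c * (s * q) + d = e * (t * q) + f], the common member sought. *)
case: (egcdnP e c0) => s t st _.
exists (c * (s * q) + d); split; first by exists (s * q).
exists (t * q) => //.
rewrite -(subnK df) fd addnA; congr (_ + _).
by rewrite !mulnA (mulnC c) st mulnDl (mulnC e) (mulnC q).
Qed.

Lemma progrI_lcm c d e f : d < c -> f < e ->
  progr c d `&` progr e f !=set0 ->
  exists2 r, r < lcmn c e &
    progr c d `&` progr e f = progr (lcmn c e) r.
Proof.
move=> dc fe [z [/(progrP dc) zd /(progrP fe) zf]].
have L0 : 0 < lcmn c e by rewrite lcmn_gt0 (leq_ltn_trans _ dc)// (leq_ltn_trans _ fe).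
(* Any common member [z] determines the intersection: lying in both classes means being congruent to
   [z] modulo [c] and [e], hence modulo their lcm. *)
exists (z %% lcmn c e); first by rewrite ltn_mod.
apply/predeqP => y; rewrite /setI/= !progrP ?ltn_mod// modn_mod.
split=> [[yd yf]|/eqP].
  by apply/eqP; rewrite eqn_mod_lcm yd zd yf zf !eqxx.
by rewrite eqn_mod_lcm => /andP[/eqP-> /eqP->].
Qed.

Lemma progr0P m k : progr m 0 k <-> m %| k.
Proof.
split=> [[n _ <-]|/dvdnP[n ->]]; first by rewrite addn0 dvdn_mulr.
by exists n; rewrite // addn0 mulnC.
Qed.

(** * Products of normal forms *)

Lemma normal_form_mul_eq0 a b c d e f g h :
  b < a -> d < c -> f < e -> h < g ->
  ~ (progr c d `&` progr e f !=set0) ->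
  (((R g h)^‡ * R e f) * ((R c d)^‡ * R a b))%pinj = pinj_eps.
Proof.
move=> ba dc fe hg nI; apply: pinj_ext => x y; split=> // /pinj_mulP[z].
move=> /(normal_formP ba dc)[n _ zn] /(normal_formP fe hg)[m zm _].
by case: nI; exists z; split; [exists n | exists m].
Qed.

(** Keeps composed indices admissible: [p * s + q < p * s.+1 <= p * t]. *)
Lemma ltn_affine p q s t : q < p -> s < t -> p * s + q < p * t.
Proof.
move=> qp st; apply: leq_trans (leq_mul (leqnn p) st).
by rewrite mulnS addnC ltn_add2r.
Qed.

(** The indices [u], [v], [w], [x] enter only through the equations that make the two readings of
    the middle value agree, so no division occurs. *)
Lemma normal_form_mul a b c d e f g h u v w x :
  b < a -> d < c -> f < e -> h < g -> v < u -> x < w ->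
  c * u = e * w -> c * v + d = e * x + f ->
  progr c d `&` progr e f = progr (c * u) (c * v + d) ->
  (((R g h)^‡ * R e f) * ((R c d)^‡ * R a b))%pinj =
  ((R (g * w) (g * x + h))^‡ * R (a * u) (a * v + b))%pinj.
Proof.
move=> ba dc fe hg vu xw cuew cvex I.
have affineM p q s t k : p * (s * k + t) + q = p * s * k + (p * t + q).
  by rewrite mulnDr mulnA addnA.
have affine_inj p q s t : q < p -> p * s + q = p * t + q -> s = t.
  by move=> /(leq_ltn_trans (leq0n q)) p0 /addIn/eqP; rewrite eqn_pmul2l// => /eqP.
apply: pinj_ext => y z; rewrite pinj_mulP normal_formP ?ltn_affine//; split.
  move=> [t] /(normal_formP ba dc)[n -> tn].
  move=> /(normal_formP fe hg)[m tm ->].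
  have : (progr c d `&` progr e f) t by split; [exists n | exists m].
  (* The middle value is [c * u * k + (c * v + d)]; cancelling the outer affine map gives
     [n = u * k + v], and likewise [m = w * k + x]. *)
  rewrite I => -[k _ kt]; exists k.
    rewrite -affineM; congr (_ * _ + _); apply: (affine_inj c d) => //.
    by rewrite -tn -kt affineM.
  rewrite -affineM; congr (_ * _ + _); apply: (affine_inj e f) => //.
  by rewrite -tm -kt affineM -cuew -cvex.
move=> [k -> ->]; exists (c * (u * k + v) + d).
  by apply/normal_formP => //; exists (u * k + v); rewrite ?affineM.
apply/normal_formP => //; exists (w * k + x); rewrite ?affineM//.
by rewrite cuew cvex.
Qed.

Lemma normal_form_mul_lcm a b c d e f g h r :
  b < a -> d < c -> f < e -> h < g -> r < lcmn c e ->
  progr c d `&` progr e f = progr (lcmn c e) r ->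
  let u := e %/ gcdn c e in
  let v := (r - d) %/ c in
  let w := c %/ gcdn c e in
  let x := (r - f) %/ e in
  [/\ [/\ d <= r, f <= r, c %| r - d & e %| r - f],
      g * x + h < g * w /\ a * v + b < a * u &
      (((R g h)^‡ * R e f) * ((R c d)^‡ * R a b) =
       (R (g * w) (g * x + h))^‡ * R (a * u) (a * v + b))%pinj].
Proof.
move=> ba dc fe hg rL I u v w x.
(* The offset [r] is itself a common member, [r = c * n + d = e * m + f]; hence [v = n] and [x = m]
   are exact quotients, and [r < c * u = e * w] bounds them. *)
have [[n _ nr] [m _ mr]] : (progr c d `&` progr e f) r by rewrite I; apply/progrP.
have c0 : 0 < c by apply: leq_ltn_trans dc.
have e0 : 0 < e by apply: leq_ltn_trans fe.
have cu : c * u = lcmn c e by rewrite /u muln_divA// dvdn_gcdr.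
have ew : e * w = lcmn c e by rewrite /w muln_divA ?dvdn_gcdl// mulnC.
have vE : v = n by rewrite /v -nr addnK mulKn.
have xE : x = m by rewrite /x -mr addnK mulKn.
have vu : v < u.
  by rewrite vE -(ltn_pmul2l c0) cu (leq_ltn_trans _ rL)// -nr leq_addr.
have xw : x < w.
  by rewrite xE -(ltn_pmul2l e0) ew (leq_ltn_trans _ rL)// -mr leq_addr.
split.
- split; [by rewrite -nr leq_addl | by rewrite -mr leq_addl | |].
    by rewrite -nr addnK dvdn_mulr.
  by rewrite -mr addnK dvdn_mulr.
- by split; apply: ltn_affine.
- by apply: normal_form_mul => //; rewrite ?cu ?ew ?vE ?xE ?nr ?mr.
Qed.

Lemma arith_monoid_normal_form F : arith_monoid F ->
  F = pinj_eps \/ exists a b c d,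
    [/\ b < a, d < c & F = ((R c d)^‡ * R a b)%pinj].
Proof.
have mul0 G : (pinj_eps * G)%pinj = pinj_eps.
  by apply: pinj_ext => x y; split=> // /pinj_mulP[].
have mulr0 G : (G * pinj_eps)%pinj = pinj_eps.
  by apply: pinj_ext => x y; split=> // /pinj_mulP[].
(* By minimality it suffices that the normal forms with zero contain the generators and are closed
   under product and inverse. *)
apply: (smallest_sub (X := [set G | G = pinj_eps \/ _])); last first.
  move=> _ [a [b [ba ->]]]; right; exists a, b, 1, 0.
  by split=> //; exact: R_normal_form.
split=> [G H|G] [->|[a [b [c [d [ba dc ->]]]]]].
- by left.
- move=> [->|[a' [b' [c' [d' [ba' dc' ->]]]]]]; first by left.
  have [I|nI] := pselect (progr c' d' `&` progr a b !=set0); last first.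
    by left; exact: normal_form_mul_eq0.
  have [r rL Ir] := progrI_lcm dc' ba I.
  have [_ [? ?] ->] := normal_form_mul_lcm ba' dc' ba dc rL Ir.
  by right; do 4!eexists; split; last reflexivity.
- by left; apply: pinj_ext => x y; split=> // /pinv_funP.
- by right; exists c, d, a, b; split=> //; exact: normal_form_inv.
Qed.

Theorem theorem24 :
  (forall F : pinj, arith_monoid F -> F <> pinj_eps ->
     exists a b c d : nat,
       [/\ b < a, d < c & F = ((R c d)^‡ * R a b)%pinj])
  /\
  (forall a b c d e f g h : nat,
     b < a -> d < c -> f < e -> h < g ->
     let prod := (((R g h)^‡ * R e f) * ((R c d)^‡ * R a b))%pinj in
     let is_r r :=
       r < lcmn c e /\ progr c d `&` progr e f = progr (lcmn c e) r in
     (progr (gcdn c e) 0 `|d - f|%N ->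
        (exists! r : nat, is_r r) /\
        (forall r : nat, is_r r ->
           let u := e %/ gcdn c e in
           let v := (r - d) %/ c in
           let w := c %/ gcdn c e in
           let x := (r - f) %/ e in
           [/\ (* the subtractions and divisions in v and x are exact *)
               [/\ d <= r, f <= r, c %| r - d & e %| r - f],
               (* the indices of the result are admissible *)
               g * x + h < g * w /\ a * v + b < a * u,
               prod = ((R (g * w) (g * x + h))^‡ * R (a * u) (a * v + b))%pinj,
               prod = ((R ((g * c) %/ gcdn c e) ((g * (r - f)) %/ e + h))^‡
                       * R ((a * e) %/ gcdn c e) ((a * (r - d)) %/ c + b))%pinj
             & prod = ((R ((g * lcmn c e) %/ e) ((g * (r - f)) %/ e + h))^‡
                       * R ((a * lcmn c e) %/ c) ((a * (r - d)) %/ c + b))%pinj]))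
     /\
     (~ progr (gcdn c e) 0 `|d - f|%N -> prod = pinj_eps)).
Proof.
split=> [F /arith_monoid_normal_form[]// |].
move=> a b c d e f g h ba dc fe hg prod is_r.
have c0 : 0 < c by apply: leq_ltn_trans dc.
have e0 : 0 < e by apply: leq_ltn_trans fe.
split=> [/progr0P /(dvd_progrI c0 e0) I|ndf].
  split=> [|r [rL Ir] u v w x].
    have [r rL Ir] := progrI_lcm dc fe I.
    exists r; split=> // s [sL Is].
    (* Two admissible offsets describe the same intersection, and an offset below the modulus is
       determined by its class. *)
    by apply: (progr_inj rL sL); rewrite -Ir.
  have [div lt prodE] := normal_form_mul_lcm ba dc fe hg rL Ir.
  have [_ _ cr er] := div.
  (* The explicit forms have the same indices, since all divisions are exact and [lcmn c e] is both
     [c * u] and [e * w]. *)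
  have gE : (g * c) %/ gcdn c e = g * w by rewrite muln_divA ?dvdn_gcdl.
  have aE : (a * e) %/ gcdn c e = a * u by rewrite muln_divA ?dvdn_gcdr.
  have gL : (g * lcmn c e) %/ e = g * w.
    by rewrite -muln_divA ?dvdn_lcmr// lcmnC /lcmn -muln_divA ?dvdn_gcdr// mulKn// gcdnC.
  have aL : (a * lcmn c e) %/ c = a * u.
    by rewrite -muln_divA ?dvdn_lcml// /lcmn -muln_divA ?dvdn_gcdr// mulKn.
  by rewrite gE aE gL aL -!muln_divA.
apply: normal_form_mul_eq0 => // I; apply: ndf; apply/progr0P.
exact: progrI_dvd.
Qed.
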